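(* Let $p$ be a polynomial with complex coefficients of degree at least $2$. Then the second iterate $p^2=p\circ p$ has a fixed point $\xi\in\mathbb{C}$ satisfying $|(p^2)'(\xi)|\geq 4$.
   Context: The notation $p^2$ denotes the second iterate $p\circ p$, not the square of $p$; a fixed point of $p^2$ is a point $\xi\in\mathbb{C}$ with $p(p(\xi))=\xi$. *)

(* Defs.v *)
From mathcomp Require Export all_boot all_order all_algebra.
From mathcomp Require Export reals complex.

Export Order.TTheory GRing.Theory Num.Theory.

(* Main.v *)
(** Write [q] for the second iterate of [p] and [n] for the degree of [p]. For a
polynomial [P] of degree [n >= 2], the sum [S(P)] of [P'] over the roots of [P -
w] does not depend on [w], and the sum over the roots of [P - (u X + w)] is
[S(P) + u (n^2 - n)]. Splitting the roots of [p \o p] into fibres gives [S(q) =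
S(p)^2]. With [N = n^2], the multipliers of the fixed points of [q] therefore
sum to [S^2 + N^2 - N], where [S] is the sum of the multipliers of the fixed
points of [p] minus the real number [n^2 - n].

If every multiplier of [q] had modulus [< 4], those of [p] would have modulus [<
2], so [|Im S| < 2 n] and the sum of the multipliers of [q] would have real part
[> N^2 - 5 N], which for [n >= 3] is at least [4 N]: a contradiction. For [n =
2] the fixed points of [p] have multipliers [1 + s] and [1 - s], and the 2-cycle
has multiplier [5 - s^2]; one of [(1 + s)^2], [(1 - s)^2], [5 - s^2] has modulus
at least 4. *)
Require Import Defs.
From mathcomp Require Import all_boot all_order all_algebra.
From mathcomp Require Import reals complex.
From mathcomp Require Import ring lra zify.
Import Order.TTheory GRing.Theory Num.Theory.
Local Open Scope ring_scope.
Local Open Scope complex_scope.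

(** * Sums of a derivative over the roots of a polynomial *)

(** Let [P] be the product. Modulo [P], [g] times P' is the sum of the [g.[r]] times P / (X - r),
    counted with multiplicity; each such quotient is monic of degree [size rs - 1], so the top
    coefficient of the remainder is the sum of the [g.[r]]. *)
Lemma deriv_roots_division (C : comNzRingType) (rs : seq C) (g : {poly C}) :
  exists e b : {poly C},
    [/\ g * (\prod_(r <- rs) ('X - r%:P))^`() =
          e * \prod_(r <- rs) ('X - r%:P) + b,
        (size b <= size rs)%N
      & b`_(size rs).-1 = \sum_(r <- rs) g.[r]].
Proof.
elim: rs => [|r rs [e [b [eq_b sz_b co_b]]]].
  exists 0, 0; rewrite !big_nil -[1]/(1%:P) derivC !(mulr0, mul0r) addr0.
  by rewrite size_poly0 coef0.
have /factor_theorem[k eq_k] : root (g - g.[r]%:P) r.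
  by rewrite rootE !hornerE subrr.
have {eq_k}eq_g : g = g.[r]%:P + k * ('X - r%:P) by rewrite -eq_k addrC subrK.
set P := \prod_(s <- rs) _ in eq_b.
have szP : size P = (size rs).+1 by rewrite size_prod_XsubC.
exists (k + e), (g.[r]%:P * P + ('X - r%:P) * b); split.
- rewrite big_cons -/P derivM derivXsubC mul1r mulrDr mulrCA eq_b.
  rewrite {1}eq_g; ring.
- apply: leq_trans (size_polyD _ _) _; rewrite geq_max; apply/andP; split.
    by apply: leq_trans (size_polyMleq _ _) _; rewrite szP size_polyC; case: eqP.
  apply: leq_trans (size_polyMleq _ _) _.
  by rewrite size_XsubC addSn add1n /= ltnS.
rewrite big_cons /= coefD coefCM mulrBl coefB coefXM coefCM.
have -> : P`_(size rs) = 1.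
  have /monicP := monic_prod_XsubC rs predT id.
  by rewrite -/P lead_coefE szP.
rewrite mulr1 [X in _ * X]nth_default // mulr0 subr0.
(* When [rs] is empty, the predecessor is truncated, but then the size bound forces [b = 0]. *)
congr (_ + _); case: (size rs) sz_b co_b => [|n] //=.
by rewrite leqn0 size_poly_eq0 => /eqP ->; rewrite coef0.
Qed.

(* The sum is read off the coefficient of degree [n - 1] in the remainder of
   [P' * R'] modulo [R := P - (u X + w)]; that remainder is obtained from the
   one of [P'^2] modulo [P]. *)
Lemma sum_deriv_roots (C : numFieldType) (P : {poly C}) (n : nat) :
  (2 <= n)%N -> size P = n.+1 ->
  exists S : C, forall (u w c : C) (rs : seq C),
    P - (u *: 'X + w%:P) = c *: \prod_(r <- rs) ('X - r%:P) ->
    \sum_(r <- rs) P^`().[r] = S + u * (n%:R ^+ 2 - n%:R).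
Proof.
move=> n_ge2 szP; set D := P^`(); set a := lead_coef P.
have P_neq0 : P != 0 by rewrite -size_poly_gt0 szP.
have a_neq0 : a != 0 by rewrite lead_coef_eq0.
have n_gt0 : (0 < n)%N by apply: ltnW.
have co_D : D`_n.-1 = n%:R * a.
  by rewrite coef_deriv prednK // /a lead_coefE szP mulr_natl.
have szD : size D = n.
  apply/eqP; rewrite eqn_leq; apply/andP; split.
    by rewrite -ltnS -szP lt_size_deriv.
  rewrite -[leqLHS]prednK // ltnNge; apply/negP => /leq_sizeP/(_ _ (leqnn _)).
  move/eqP; rewrite co_D mulf_eq0 (negPf a_neq0) orbF pnatr_eq0.
  by rewrite -leqn0 leqNgt n_gt0.
pose A : {poly C} := D ^+ 2 %/ P; pose B : {poly C} := D ^+ 2 %% P.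
have szB : (size B <= n)%N by rewrite -ltnS -szP ltn_modp.
have eqAB : D ^+ 2 - B = A * P by rewrite {1}(divp_eq (D ^+ 2) P) addrK.
clearbody A B.
have D_neq0 : D != 0 by rewrite -size_poly_gt0 szD ltnW.
have szDD : size (D ^+ 2) = (n + n).-1 by rewrite size_mul ?szD.
have szAP : size (A * P) = (n + n).-1.
  rewrite -eqAB size_polyDl ?szDD // size_polyN; apply: leq_ltn_trans szB _; lia.
have lAP : lead_coef A * a = (n%:R * a) ^+ 2.
  rewrite -lead_coefM -eqAB lead_coefDl ?size_polyN ?szDD.
    by rewrite lead_coefM lead_coefE szD co_D.
  by apply: leq_ltn_trans szB _; lia.
have A_neq0 : A != 0.
  by apply/eqP=> A0; move: szAP; rewrite A0 mul0r size_poly0; lia.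
have szA : size A = n.-1.
  move: szAP; rewrite size_mul // szP addnS /=; move: (size A) => m.
  clear -n_ge2; lia.
have lA : A`_n.-2 = n%:R ^+ 2 * a.
  apply: (mulIf a_neq0); move: lAP; rewrite lead_coefE szA => ->; ring.
exists (B`_n.-1 / a) => u w c rs.
pose L : {poly C} := u *: 'X + w%:P; rewrite -/L => eqR.
have szL : (size L <= 2)%N.
  rewrite (leq_trans (size_polyD _ _)) // geq_max.
  rewrite (leq_trans (size_scale_leq _ _)) ?size_polyX //=.
  by rewrite (leq_trans (size_polyC_leq1 _)).
have ltL : (size (- L) < size P)%N.
  by rewrite size_polyN szP (leq_ltn_trans szL).
have lR : a = c.
  rewrite /a -(lead_coefDl ltL) eqR lead_coefZ.
  by rewrite (monicP (monic_prod_XsubC _ _ _)) mulr1.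
have szrs : size rs = n.
  have := size_polyDl ltL; rewrite eqR size_scale -?lR // size_prod_XsubC szP.
  by case.
have dR : D - u%:P = c *: (\prod_(r <- rs) ('X - r%:P))^`().
  by rewrite -derivZ -eqR !derivE addr0 -/D alg_polyC.
have [e [b [eq_b sz_b co_b]]] := deriv_roots_division C rs D.
rewrite szrs in sz_b co_b.
(* [c *: b] and [A * L + B - u *: D] are both congruent to [D * (D - u%:P)] modulo [P - L]; having
   size at most [n], they must coincide. *)
have eq_b' : (A - e) * (P - L) = c *: b - (A * L + B - u *: D).
  have E : D * (D - u%:P) = e * (P - L) + c *: b.
    by rewrite dR eqR -!scalerAr eq_b scalerDr.
  have E' : D * (D - u%:P) = A * P + B - u *: D.
    by rewrite mulrBr -expr2 -eqAB subrK [D * _]mulrC mul_polyC.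
  rewrite mulrBl [A * (P - L)]mulrBr.
  have -> : e * (P - L) = A * P + B - u *: D - c *: b by rewrite -E' E addrK.
  ring.
have sz_b' : (size (c *: b - (A * L + B - u *: D))%R <= n)%N.
  rewrite (leq_trans (size_polyD _ _)) // geq_max size_polyN.
  rewrite (leq_trans (size_scale_leq _ _)) //=.
  rewrite (leq_trans (size_polyD _ _)) // geq_max size_polyN.
  rewrite [X in _ && X](leq_trans (size_scale_leq _ _)) ?szD // andbT.
  rewrite (leq_trans (size_polyD _ _)) // geq_max szB andbT.
  by rewrite (leq_trans (size_polyMleq _ _)) // szA; lia.
have /eqP : c *: b - (A * L + B - u *: D) = 0.
  apply/eqP; apply: contraLR sz_b'; rewrite -eq_b' -ltnNge => nz.
  have [eA0 PL0] : A - e != 0 /\ P - L != 0.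
    by apply/andP; rewrite -negb_or -mulf_eq0.
  rewrite size_mul // (size_polyDl ltL) szP addnS /=.
  by rewrite -[X in (X < _)%N]add0n ltn_add2r size_poly_gt0.
(* Since [A] has degree [n - 2], [w] does not reach degree [n - 1]: there [A * L] contributes
   [u * n^2 * a] and [u *: D] contributes [u * n * a]. *)
rewrite subr_eq0 => /eqP/(congr1 (fun q : {poly C} => q`_n.-1)).
rewrite coefZ co_b coefB coefD coefZ co_D mulrDr coefD.
rewrite -scalerAr coefZ coefMX mulrC coefMC [A`_n.-1]nth_default ?szA //.
have -> : (n.-1 == 0)%N = false by lia.
rewrite lA -lR mul0r addr0 => eqS.
apply: (mulIf a_neq0); rewrite [LHS]eqS mulrDl divfK //; ring.
Qed.

(** By the chain rule, the fibre of [p] over a root [s] of [p - w] contributes p'(s) times [S];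
    summing over [s] gives [S ^+ 2]. One factorisation is enough, as [sum_deriv_roots] makes the sum
    the same for all. *)
Lemma sum_deriv_roots_comp (C : numClosedFieldType) (p : {poly C})
    (S w : C) :
  (forall (v c : C) (rs : seq C),
    p - v%:P = c *: \prod_(r <- rs) ('X - r%:P) ->
    \sum_(r <- rs) p^`().[r] = S) ->
  exists (c : C) (rs : seq C),
    p \Po p - w%:P = c *: \prod_(r <- rs) ('X - r%:P)
    /\ \sum_(r <- rs) (p \Po p)^`().[r] = S ^+ 2.
Proof.
move=> sumS.
pose rts (v : C) := sval (closed_field_poly_normal (p - v%:P)).
have rtsP v : p - v%:P = lead_coef (p - v%:P) *: \prod_(r <- rts v) ('X - r%:P).
  exact: svalP (closed_field_poly_normal (p - v%:P)).
have rtsS v : \sum_(r <- rts v) p^`().[r] = S by apply: sumS (rtsP v).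
have rts_root v r : r \in rts v -> p.[r] = v.
  move=> r_in; apply/eqP; rewrite -subr_eq0.
  have -> : p.[r] - v = (p - v%:P).[r] by rewrite !hornerE.
  by rewrite rtsP hornerZ -/(root _ _) mulf_eq0 -rootE root_prod_XsubC r_in orbT.
pose a v := lead_coef (p - v%:P).
exists (a w * \prod_(s <- rts w) a s), (flatten [seq rts s | s <- rts w]).
split.
  have -> : p \Po p - w%:P = (p - w%:P) \Po p.
    by rewrite comp_polyB comp_polyC.
  rewrite {1}rtsP comp_polyZ -scalerA; congr (_ *: _).
  rewrite rmorph_prod /= big_flatten big_map -scaler_prod.
  by apply: eq_bigr => s _; rewrite comp_polyB comp_polyX comp_polyC {1}rtsP.
rewrite big_flatten big_map expr2 -{1}(rtsS w) mulr_suml big_seq [RHS]big_seq.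
apply: eq_bigr => s _; rewrite -(rtsS s) mulr_sumr big_seq [RHS]big_seq.
apply: eq_bigr => r r_in.
by rewrite deriv_comp hornerM horner_comp (rts_root s).
Qed.

Lemma le_complex_norm (R : rcfType) (r : R) (z : R[i]) :
  0 <= r ->
  (r%:C <= `|z|) = (r ^+ 2 <= complex.Re z ^+ 2 + complex.Im z ^+ 2).
Proof.
move=> r_ge0; rewrite -[_ <= `|z|]ler_sqr ?nnegrE ?normr_ge0 //; last first.
  by rewrite lecE /= eqxx.
by rewrite -add_Re2_Im2 -rmorphXn lecR.
Qed.

Lemma ltr_norm_sum (R : numDomainType) (I : eqType) (rs : seq I) (f : I -> R)
    (k : R) :
  (0 < size rs)%N -> {in rs, forall r, `|f r| < k} ->
  `|\sum_(r <- rs) f r| < k * (size rs)%:R.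
Proof.
case: rs => // x rs _; elim: rs x => [|y rs IHrs] x lt_k.
  by rewrite big_seq1 mulr1 lt_k ?mem_head.
rewrite big_cons (le_lt_trans (ler_normD _ _)) // [size _]/= -natr1 mulrDr.
rewrite mulr1 addrC ltrD ?lt_k ?mem_head //; apply: IHrs => r r_in.
by rewrite lt_k // in_cons r_in orbT.
Qed.

(** * Quadratic polynomials *)

Lemma multiplier_ge4_quadratic (R : rcfType) (p : {poly R[i]}) :
  size p = 3%N ->
  exists xi : R[i],
    (p \Po p).[xi] = xi /\ 4 <= `|((p \Po p)^`()).[xi]|.
Proof.
move=> szp; set a := p`_2; set b := p`_1; set c := p`_0.
have a_neq0 : a != 0.
  by rewrite /a -[2%N]/(3.-1) -szp -lead_coefE lead_coef_eq0 -size_poly_gt0 szp.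
have pE x : p.[x] = a * x ^+ 2 + b * x + c.
  rewrite horner_coef szp !big_ord_recl big_ord0 /= /bump /= -/a -/b -/c; ring.
have dE x : p^`().[x] = 2 * a * x + b.
  rewrite (@horner_coef_wide _ 2); last first.
    by rewrite -ltnS -szp lt_size_deriv // -size_poly_gt0 szp.
  rewrite !big_ord_recl big_ord0 /= /bump /= !coef_deriv -/a -/b; ring.
have qE x : (p \Po p).[x] = p.[p.[x]] by rewrite horner_comp.
have dqE x : ((p \Po p)^`()).[x] = p^`().[p.[x]] * p^`().[x].
  by rewrite deriv_comp hornerM horner_comp.
(* [s ^+ 2] is the discriminant of [p - 'X]. The sign of [s] makes [1 + s] the larger in modulus of
   the multipliers [1 + s] and [1 - s]. *)
have [s s_ge0 s2E] : exists2 s : R[i], 0 <= complex.Re s &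
    s ^+ 2 = (b - 1) ^+ 2 - 4 * a * c.
  set D := _ - _; pose s := sqrtC D.
  have [s_ge0|s_lt0] := leP 0 (complex.Re s); first by exists s; rewrite ?sqrtCK.
  exists (- s); last by rewrite sqrrN sqrtCK.
  by rewrite raddfN oppr_ge0 ltW.
have four_ge0 : (0 : R) <= 4 by rewrite ler0n.
have fourE : (4 : R[i]) = (4 : R)%:C by rewrite rmorph_nat.
have [mu_ge|mu_lt] := boolP (4 <= `|5 - s ^+ 2|).
  (* Up to the factor [a ^+ 2], [t ^+ 2] is the discriminant of the quadratic (q - X) / (p - X),
     with q the second iterate. At its two roots p' equals [t - 1] and [- t - 1], with product
     [1 - t ^+ 2 = 5 - s ^+ 2]. *)
  pose t := sqrtC (s ^+ 2 - 4).
  have cE : c = ((b - 1) ^+ 2 - (t ^+ 2 + 4)) / (4 * a).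
    by rewrite sqrtCK s2E; field.
  have sE : s ^+ 2 = t ^+ 2 + 4 by rewrite sqrtCK subrK.
  exists ((t - b - 1) / (2 * a)); rewrite qE dqE !dE !pE cE; split.
    by field.
  suff <- : 5 - s ^+ 2 = (2 * a * (a * ((t - b - 1) / (2 * a)) ^+ 2 +
     b * ((t - b - 1) / (2 * a)) + ((b - 1) ^+ 2 - (t ^+ 2 + 4)) / (4 * a)) + b) *
     (2 * a * ((t - b - 1) / (2 * a)) + b) by [].
  by rewrite sE; field.
have cE : c = ((b - 1) ^+ 2 - s ^+ 2) / (4 * a).
  by rewrite s2E; field.
pose z := (s + 1 - b) / (2 * a).
have pz : p.[z] = z by rewrite pE cE /z; field.
have dz : p^`().[z] = 1 + s by rewrite dE /z; field.
exists z; rewrite qE dqE !pz dz; split=> //; rewrite -expr2 normrX.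
rewrite -add_Re2_Im2 fourE lecR.
move: mu_lt; rewrite fourE le_complex_norm // -ltNge.
case: s s_ge0 {s2E cE z pz dz} => x y /= x_ge0.
(* The real part of [s ^+ 2] exceeds 1, so [s] has real part at least 1 and [1 + s] has modulus at
   least 2. *)
move=> lt16; have lt4 : 5 - (x * x - y * y) < 4.
  by rewrite ltNge; apply/negP => ge4; move: lt16; nra.
have x_ge1 : 1 <= x by nra.
by nra.
Qed.

(** * Degree at least 3 *)

Lemma norm_square_shift_contra (R : rcfType) (S : R[i]) (m : R) :
  3 <= m -> `|S + (m%:C ^+ 2 - m%:C)| < 2 * m%:C ->
  `|S ^+ 2 + ((m%:C * m%:C) ^+ 2 - m%:C * m%:C)| < 4 * (m%:C * m%:C) -> False.
Proof.
move=> m_ge3.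
have -> : 2 * m%:C = (2 * m)%:C by rewrite rmorphM rmorph_nat.
have -> : 4 * (m%:C * m%:C) = (4 * (m * m))%:C by rewrite !rmorphM rmorph_nat.
move=> /lt_geF/negbT; rewrite le_complex_norm -?ltNge; last by lra.
move=> lt1 /lt_geF/negbT; rewrite le_complex_norm -?ltNge; last by nra.
case: S lt1 => x y /= lt1 lt2.
rewrite !(mulr0, mul0r, subr0, addr0) in lt1 lt2.
have y2_lt : y ^+ 2 < 4 * m ^+ 2.
  by have := sqr_ge0 (x + (m * m - m)); move: lt1; rewrite exprMn -natrX; lra.
set w := x * x - y * y + _ in lt2.
(* This is the inequality [m^4 - 5 m^2 >= 4 m^2] divided by [m^2]. *)
have m2_ge9 : 9 <= m ^+ 2 by nra.
have w_ge : 4 * (m * m) <= w.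
  rewrite /w; have := sqr_ge0 x; move: m2_ge9 y2_lt; rewrite !expr2.
  by move: (m * m) (y * y) (x * x) => M Y X; nra.
have : (4 * (m * m)) ^+ 2 <= w ^+ 2 by rewrite ler_sqr ?nnegrE //; nra.
have := sqr_ge0 (x * y + y * x); lra.
Qed.

Theorem theorem3 (R : realType) (p : {poly R[i]}) (hp : (2 <= (size p).-1)%N) :
  exists xi : R[i],
    (p \Po p).[xi] = xi /\ 4 <= `|((p \Po p)^`()).[xi]|.
Proof.
set n := (size p).-1 in hp.
have szp : size p = n.+1.
  by rewrite prednK // (leq_trans _ (leq_trans hp (leq_pred _))).
have [n2|n_neq2] := eqVneq n 2%N.
  by apply: multiplier_ge4_quadratic; rewrite szp n2.
have n_ge3 : (3 <= n)%N by rewrite ltn_neqAle eq_sym n_neq2.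
clearbody n.
set q := p \Po p.
have szq : size q = (n * n).+1.
  have := size_comp_poly p p; rewrite szp -/q /=.
  by case: (size q) => [|k /= ->] //; clear -n_ge3; nia.
have [S sumS] := sum_deriv_roots _ _ _ hp szp.
have nn_ge2 : (2 <= n * n)%N by clear -n_ge3; nia.
have [T sumT] := sum_deriv_roots _ _ _ nn_ge2 szq.
(* [T] is the same for every [u] and [w], so it is computed at [u = w = 0], where the roots split
   into fibres. *)
have TE : T = S ^+ 2.
  have [|c [rs [eq_q <-]]] := sum_deriv_roots_comp _ p S 0.
    move=> v c rs eq_p; rewrite (sumS 0 v c) ?mul0r ?addr0 //.
    by rewrite scale0r add0r.
  have eq_q' : q - (0 *: 'X + 0%:P) = c *: \prod_(r <- rs) ('X - r%:P).
    by rewrite scale0r add0r.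
  by rewrite (sumT _ _ _ _ eq_q') mul0r addr0.
(* [rp] and [rq] list fixed points with multiplicity, so their lengths are exactly [n] and
   [n * n]. *)
have [rp rpE] := closed_field_poly_normal (p - 'X).
have [rq rqE] := closed_field_poly_normal (q - 'X).
have ltX (g : {poly R[i]}) : (2 < size g)%N -> (size (- 'X : {poly R[i]}) < size g)%N.
  by rewrite size_polyN size_polyX.
have lead_neq0 (g : {poly R[i]}) : (2 < size g)%N -> lead_coef (g - 'X) != 0.
  move=> sz_g; rewrite lead_coef_eq0 -size_poly_gt0 size_polyDl ?ltX //.
  exact: leq_trans sz_g.
have rootsE (g : {poly R[i]}) rs r :
    g - 'X = lead_coef (g - 'X) *: \prod_(z <- rs) ('X - z%:P) ->
    (2 < size g)%N -> (r \in rs) = (g.[r] == r).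
  move=> gE sz_g; rewrite -subr_eq0.
  have -> : g.[r] - r = (g - 'X).[r] by rewrite !hornerE.
  by rewrite -rootE gE rootZ ?root_prod_XsubC ?lead_neq0.
have size_roots (g : {poly R[i]}) rs :
    g - 'X = lead_coef (g - 'X) *: \prod_(z <- rs) ('X - z%:P) ->
    (2 < size g)%N -> size g = (size rs).+1.
  move=> gE sz_g.
  rewrite -(size_polyDl (ltX _ sz_g)) {1}gE size_scale ?lead_neq0 //.
  by rewrite size_prod_XsubC.
have szp_gt2 : (2 < size p)%N by rewrite szp ltnS.
have szq_gt2 : (2 < size q)%N by rewrite szq ltnS.
have szrp : size rp = n by have := size_roots _ _ rpE szp_gt2; rewrite szp => -[].
have szrq : size rq = (n * n)%N.
  by have := size_roots _ _ rqE szq_gt2; rewrite szq => -[].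
have in_rp r : (r \in rp) = (p.[r] == r) by apply: rootsE.
have in_rq r : (r \in rq) = (q.[r] == r) by apply: rootsE.
have [/hasP[xi xi_in ge4]|/hasPn lt4] := boolP (has (fun xi => 4 <= `|q^`().[xi]|) rq).
  by exists xi; split=> //; apply/eqP; rewrite -in_rq.
have lt_q : {in rq, forall r, `|q^`().[r]| < 4}.
  by move=> r /lt4; rewrite -real_ltNge ?normr_real ?realn.
have lt_p : {in rp, forall r, `|p^`().[r]| < 2}.
  move=> r; rewrite in_rp => /eqP pr.
  have /lt_q : r \in rq by rewrite in_rq horner_comp !pr.
  rewrite deriv_comp hornerM horner_comp pr -expr2 normrX.
  have -> : (4 : R[i]) = 2 ^+ 2 by rewrite -natrX.
  by rewrite ltr_sqr ?nnegrE.
have := ltr_norm_sum _ _ rp (fun r => p^`().[r]) 2; rewrite szrp.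
move=> /(_ (ltnW hp) lt_p).
have := ltr_norm_sum _ _ rq (fun r => q^`().[r]) 4; rewrite szrq.
move=> /(_ (ltnW nn_ge2) lt_q).
(* At [u = 1], [w = 0] the roots are the fixed points, and the two sums become [S + (n^2 - n)] and
   [S^2 + (n^4 - n^2)]. *)
have XE : 1 *: 'X + 0%:P = 'X :> {poly R[i]} by rewrite scale1r addr0.
rewrite (sumT 1 0 (lead_coef (q - 'X))) ?XE //.
rewrite (sumS 1 0 (lead_coef (p - 'X))) ?XE // {}TE !mul1r.
rewrite natrM => lt4N lt2n.
have := norm_square_shift_contra R S n%:R; rewrite ler_nat rmorph_nat => /(_ n_ge3).
by move=> /(_ lt2n lt4N).
Qed.
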